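(* Let $p_{\mathbf{x}}$ be a probability distribution on $\mathbb{R}^n$ that is non-degenerate over $\mathbb{R}^n$ (i.e., not supported on a set of dimension lower than $n$). Fix $\sigma>0$ and let $\mathsf{D}_\sigma:\mathbb{R}^n\to\mathbb{R}^n$ be the MMSE denoiser $$\mathsf{D}_\sigma(\mathbf{z}) = \mathbb{E}[\mathbf{x}\mid \mathbf{z}] = \int_{\mathbb{R}^n} \mathbf{x}\, p_{\mathbf{x}|\mathbf{z}}(\mathbf{x}|\mathbf{z})\,\mathrm{d}\mathbf{x},$$ for the AWGN model $\mathbf{z}=\mathbf{x}+\mathbf{n}$ with $\mathbf{x}\sim p_{\mathbf{x}}$ and $\mathbf{n}\sim\mathcal{N}(\mathbf{0},\sigma^2\mathbf{I})$ independent. Let $g:\mathbb{R}^n\to\mathbb{R}$ be continuously differentiable with $L$-Lipschitz continuous gradient for some $L>0$, and fix a step size $0<\gamma\le 1/L$. Define $h$ and $f=g+h$ as in the context, and assume $f$ has a finite infimum $f^\ast>-\infty$. Let $\mathbf{x}^0\in\mathbb{R}^n$ and run PnP-ISTA: for $t\ge 1$, $$\mathbf{z}^t=\mathbf{x}^{t-1}-\gamma\nabla g(\mathbf{x}^{t-1}),\qquad \mathbf{x}^t=\mathsf{D}_\sigma(\mathbf{z}^t).$$ Then the sequence $\{f(\mathbf{x}^t)\}_{t\ge 0}$ is monotonically decreasing (nonincreasing), and $\|\nabla f(\mathbf{x}^t)\|\to 0$ as $t\to\infty$.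
   Context: Notation: $p_{\mathbf{z}}=p_{\mathbf{x}}\ast\phi_\sigma$ is the density of the noisy observation $\mathbf{z}$, where $\phi_\sigma(\mathbf{x})=(2\pi\sigma^2)^{-n/2}\exp(-\|\mathbf{x}\|^2/(2\sigma^2))$, and $h_\sigma(\cdot)=-\log p_{\mathbf{z}}(\cdot)$. Let $\mathcal{X}=\mathrm{Im}(\mathsf{D}_\sigma)$. Under the non-degeneracy assumption, $\mathsf{D}_\sigma$ is a one-to-one smooth map from $\mathbb{R}^n$ onto $\mathcal{X}$ with smooth inverse $\mathsf{D}_\sigma^{-1}:\mathcal{X}\to\mathbb{R}^n$. The regularizer $h:\mathbb{R}^n\to\mathbb{R}\cup\{+\infty\}$ is defined by $$h(\mathbf{x})=\begin{cases}-\frac{1}{2\gamma}\|\mathbf{x}-\mathsf{D}_\sigma^{-1}(\mathbf{x})\|^2+\frac{\sigma^2}{\gamma}h_\sigma(\mathsf{D}_\sigma^{-1}(\mathbf{x})) & \mathbf{x}\in\mathcal{X},\\ +\infty & \mathbf{x}\notin\mathcal{X},\end{cases}$$ which is smooth on $\mathcal{X}$, and the global cost is $f(\mathbf{x})=g(\mathbf{x})+h(\mathbf{x})$; $\nabla f(\mathbf{x}^t)$ is the gradient of $f$ at the iterates $\mathbf{x}^t\in\mathcal{X}$. *)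

(* Defs.v *)
From HB Require Import structures.
From mathcomp Require Import all_boot all_order all_algebra.
From mathcomp Require Import all_classical all_reals all_analysis.
Set Implicit Arguments. Unset Strict Implicit. Unset Printing Implicit Defensive.
Import Order.TTheory GRing.Theory Num.Theory.
Import numFieldNormedType.Exports.
Local Open Scope classical_set_scope.
Local Open Scope ring_scope.

Definition dotv {R : realType} {n : nat} (u v : 'rV[R]_n) : R :=
  \sum_(i < n) u ord0 i * v ord0 i.
Definition enorm {R : realType} {n : nat} (v : 'rV[R]_n) : R :=
  Num.sqrt (dotv v v).

Definition gauss {R : realType} {n : nat} (sigma : R) (v : 'rV[R]_n) : R :=
  (Num.sqrt (2 * pi * sigma ^+ 2)) ^- n
  * expR (- (enorm v ^+ 2) / (2 * sigma ^+ 2)).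

(* The prior p_x is the law of the random vector X on the probability space P
   (coordinates measurable).  p_z = p_x * phi_sigma: *)
Definition pz {d : measure_display} {T : measurableType d} {R : realType} {n : nat}
  (P : probability T R) (X : T -> 'rV[R]_n) (sigma : R) (z : 'rV[R]_n) : R :=
  Rintegral P setT (fun t => gauss sigma (z - X t)).

Definition hsigma {d : measure_display} {T : measurableType d} {R : realType} {n : nat}
  (P : probability T R) (X : T -> 'rV[R]_n) (sigma : R) (z : 'rV[R]_n) : R :=
  - ln (pz P X sigma z).

(* MMSE denoiser D_sigma(z) = E[x | z] = int x p(x|z) dx, with the posterior
   p(x|z) = p_x(x) phi_sigma(z - x) / p_z(z) (Bayes' formula). *)
Definition mmse {d : measure_display} {T : measurableType d} {R : realType} {n : nat}
  (P : probability T R) (X : T -> 'rV[R]_n) (sigma : R) (z : 'rV[R]_n) : 'rV[R]_n :=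
  \row_(i < n) (Rintegral P setT (fun t => X t ord0 i * gauss sigma (z - X t))
                / pz P X sigma z).

(* non-degenerate: p_x is not concentrated on any proper affine subspace,
   i.e. on no affine hyperplane {x | <a,x> = b}, a <> 0. *)
Definition nondeg_law {d : measure_display} {T : measurableType d} {R : realType}
  {n : nat} (P : probability T R) (X : T -> 'rV[R]_n) : Prop :=
  forall (a : 'rV[R]_n) (b : R), a != 0 ->
    (P [set t | dotv a (X t) = b] < 1)%E.

Definition grad {R : realType} {n : nat} (F : 'rV[R]_n -> R) (x : 'rV[R]_n)
  : 'rV[R]_n :=
  \row_(i < n) ('d F x (delta_mx ord0 i : 'rV[R]_n)).

Definition Dinv {R : realType} {n : nat} (D : 'rV[R]_n -> 'rV[R]_n)
  (x : 'rV[R]_n) : 'rV[R]_n := xget 0 [set z | D z = x].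

Definition hformula {d : measure_display} {T : measurableType d} {R : realType} {n : nat}
  (P : probability T R) (X : T -> 'rV[R]_n) (sigma gamma : R) (x : 'rV[R]_n) : R :=
  let z := Dinv (mmse P X sigma) x in
  - (enorm (x - z) ^+ 2) / (2 * gamma) + sigma ^+ 2 / gamma * hsigma P X sigma z.

Definition hreg {d : measure_display} {T : measurableType d} {R : realType} {n : nat}
  (P : probability T R) (X : T -> 'rV[R]_n) (sigma gamma : R) (x : 'rV[R]_n)
  : \bar R :=
  if `[< range (mmse P X sigma) x >] then (hformula P X sigma gamma x)%:E
  else +oo%E.

Definition fcost {d : measure_display} {T : measurableType d} {R : realType} {n : nat}
  (P : probability T R) (X : T -> 'rV[R]_n) (sigma gamma : R)
  (g : 'rV[R]_n -> R) (x : 'rV[R]_n) : \bar R :=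
  ((g x)%:E + hreg P X sigma gamma x)%E.

(* gradient of f at a point of X (h is smooth on X, which is open) *)
Definition gradf {d : measure_display} {T : measurableType d} {R : realType} {n : nat}
  (P : probability T R) (X : T -> 'rV[R]_n) (sigma gamma : R)
  (g : 'rV[R]_n -> R) (x : 'rV[R]_n) : 'rV[R]_n :=
  grad (fun y => g y + hformula P X sigma gamma y) x.

(* Main.v *)
Require Import Defs.
From HB Require Import structures.
From mathcomp Require Import all_boot all_order all_algebra.
From mathcomp Require Import all_classical all_reals all_analysis.
From mathcomp Require Import measurable_realfun ring lra.
Import Order.TTheory GRing.Theory Num.Theory.
Import numFieldNormedType.Exports.
Local Open Scope classical_set_scope.
Local Open Scope ring_scope.

(* Let psi(z) = |z|^2/2 + sigma^2 ln p_z(z). Jensen's inequality for exp under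
   the posterior gives the strict subgradient inequality
   psi(z) + <z' - z, D(z)> < psi(z') for z' <> z, so D is the (continuous)
   gradient of a strictly convex function. Hence D is injective, its range is
   open, its inverse is continuous, and gamma h = psi^* - |.|^2/2 on the range,
   with gradient D^{-1} - id, where psi^* is the Legendre conjugate of psi.
   By Fenchel-Young, x^{t+1} minimises the majorizer
   mu(y) = g(s) + <grad g(s), y - s> + |y - s|^2/(2 gamma) + h(y), s = x^t.
   The gap mu - f is nonnegative with (L + 1/gamma)-Lipschitz gradient, equal to
   - grad f at x^{t+1}; so |grad f(x^{t+1})|^2 is at most
   2 (L + 1/gamma) (f(x^t) - f(x^{t+1})), which tends to 0 since f decreases and
   is bounded below. *)

(** * The Euclidean pairing and its comparison with the maximum norm *)

Section dotv.
Context {R : realType} {n : nat}.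
Implicit Types (u v w : 'rV[R]_n) (a : R).

Lemma dotvC u v : dotv u v = dotv v u.
Proof. by apply: eq_bigr => i _; rewrite mulrC. Qed.

Lemma dotvDl u v w : dotv (u + v) w = dotv u w + dotv v w.
Proof. by rewrite -big_split; apply: eq_bigr => i _; rewrite mxE mulrDl. Qed.

Lemma dotvZl a u v : dotv (a *: u) v = a * dotv u v.
Proof. by rewrite mulr_sumr; apply: eq_bigr => i _; rewrite mxE mulrA. Qed.

Lemma dotvDr u v w : dotv w (u + v) = dotv w u + dotv w v.
Proof. by rewrite !(dotvC w) dotvDl. Qed.

Lemma dotvZr a u v : dotv v (a *: u) = a * dotv v u.
Proof. by rewrite !(dotvC v) dotvZl. Qed.

Lemma dotvNl u v : dotv (- u) v = - dotv u v.
Proof. by rewrite -scaleN1r dotvZl mulN1r. Qed.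

Lemma dotvNr u v : dotv v (- u) = - dotv v u.
Proof. by rewrite !(dotvC v) dotvNl. Qed.

Definition dotvE := (dotvDl, dotvDr, dotvNl, dotvNr, dotvZl, dotvZr).

Lemma dotvv_ge0 v : 0 <= dotv v v.
Proof. by apply: sumr_ge0 => i _; rewrite -expr2 sqr_ge0. Qed.

Lemma dotvv_eq0 v : (dotv v v == 0) = (v == 0).
Proof.
apply/eqP/eqP => [|->]; last by apply: big1 => i _; rewrite mxE mul0r.
move=> /eqP; rewrite psumr_eq0 => [/allP v0|i _]; last by rewrite -expr2 sqr_ge0.
apply/rowP => i; rewrite mxE; apply/eqP.
by have := v0 i; rewrite mem_index_enum mulf_eq0 orbb; apply.
Qed.

Lemma enorm_ge0 v : 0 <= enorm v.
Proof. exact: sqrtr_ge0. Qed.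

Lemma sqr_enorm v : enorm v ^+ 2 = dotv v v.
Proof. by rewrite sqr_sqrtr ?dotvv_ge0. Qed.

Lemma enormZ a v : enorm (a *: v) = `|a| * enorm v.
Proof. by rewrite /enorm dotvZl dotvZr mulrA -expr2 sqrtrM ?sqr_ge0// sqrtr_sqr. Qed.

Lemma enormN v : enorm (- v) = enorm v.
Proof. by rewrite -scaleN1r enormZ normrN1 mul1r. Qed.

(** Cauchy-Schwarz, from the nonnegative square of [dotv v v *: u - dotv u v *: v]. *)
Lemma dotv_le_enorm u v : dotv u v <= enorm u * enorm v.
Proof.
have [->|v0] := eqVneq v 0.
  by rewrite -(scale0r 0) dotvZr mul0r mulr_ge0 ?enorm_ge0.
have vv0 : 0 < dotv v v by rewrite lt_neqAle eq_sym dotvv_eq0 v0 dotvv_ge0.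
rewrite (le_trans (ler_norm _))// -ler_sqr ?nnegrE ?mulr_ge0 ?enorm_ge0//.
rewrite real_normK ?num_real// exprMn !sqr_enorm -subr_ge0 -(pmulr_rge0 _ vv0).
have := dotvv_ge0 (dotv v v *: u - dotv u v *: v).
by rewrite !dotvE (dotvC v u) => /le_trans; apply; rewrite le_eqVlt; apply/orP; left;
  apply/eqP; ring.
Qed.

Lemma ler_norm_coord v i : `|v ord0 i| <= `|v|.
Proof.
by rewrite [leRHS]mx_normrE (le_bigmax _ (fun ij => `|v ij.1 ij.2|) (ord0, i)).
Qed.

(** The norm [|v|] of a row vector is the maximum norm, hence the factor [n]. Neighbourhoods are
    measured with it, while the convexity arguments use [dotv]. *)
Lemma ler_norm_dotv u v : `|dotv u v| <= n%:R * (`|u| * `|v|).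
Proof.
rewrite (le_trans (ler_norm_sum _ _ _))// mulr_natl -[X in _ *+ X]card_ord -sumr_const.
by apply: ler_sum => i _; rewrite normrM ler_pM ?ler_norm_coord.
Qed.

Lemma cvg_dotv {T : Type} (F : set_system T) {FF : Filter F} (f g : T -> 'rV[R]_n) u v :
  f @ F --> u -> g @ F --> v -> (fun x => dotv (f x) (g x)) @ F --> dotv u v.
Proof.
move=> fu gv; apply: (cvg_big (op := +%R)).
  by move=> x; apply: add_continuous.
have cvg_coord (h : T -> 'rV[R]_n) w i : h @ F --> w -> (fun x => h x ord0 i) @ F --> w ord0 i.
  move=> hw; apply: (@cvg_comp _ _ _ h (fun M : 'rV[R]_n => M ord0 i) _ _ _ hw).
  exact: coord_continuous.
by move=> i _; apply: cvgM; exact: cvg_coord.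
Qed.

Lemma cvg_rV {T : Type} (F : set_system T) {FF : Filter F} (f : T -> 'rV[R]_n) u :
  (forall i, (fun x => f x ord0 i) @ F --> u ord0 i) -> f @ F --> u.
Proof.
move=> fu; apply/cvgrPdist_lt => e e0.
have : \forall x \near F, forall i, `|u ord0 i - f x ord0 i| < e.
  by apply: filter_forall => i; move/cvgrPdist_lt : (fu i); apply.
apply: filterS => x uf; rewrite [ltLHS]mx_normrE; apply/bigmax_ltP; split=> // -[j i] _ /=.
by rewrite !mxE !ord1.
Qed.

Lemma dotv_delta v i : dotv (delta_mx ord0 i) v = v ord0 i.
Proof.
rewrite /dotv (bigD1 i)//= mxE !eqxx mul1r big1 ?addr0// => j /negPf ij.
by rewrite mxE ij andbF mul0r.
Qed.

End dotv.

(** * Differentials represented by vectors *)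

Section gradient.
Context {R : realType} {n : nat}.
Implicit Types (q v x y : 'rV[R]_n) (F : 'rV[R]_n -> R).

Definition dotvr q v : R := dotv v q.

Lemma dotvr_is_linear q : linear (dotvr q : _ -> R^o).
Proof. by move=> a u v; rewrite /dotvr dotvDl dotvZl. Qed.
HB.instance Definition _ q :=
  GRing.isLinear.Build R 'rV[R]_n R^o *:%R (dotvr q) (dotvr_is_linear q).

Lemma dotvr_continuous q : continuous (dotvr q).
Proof. by move=> v; apply: (@cvg_dotv _ _ _ (nbhs v) _ id (cst q)); [exact: cvg_id|exact: cvg_cst]. Qed.

(** The epsilon form of a little-o expansion with candidate gradient [q]; uniqueness of the
    differential then identifies it. *)
Lemma diff_dotv F x q :
  (forall e, 0 < e -> \forall y \near x,
     `|F y - F x - dotv (y - x) q| <= e * `|y - x|) ->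
  differentiable F x /\ forall v, 'd F x v = dotv v q.
Proof.
move=> Fx.
have Fo : F \o shift x = cst (F x) + dotvr q +o_ (0 : 'rV[R]_n) id.
  apply/eqaddoP => e e0; have := Fx _ e0.
  rewrite (near_shift (0 : 'rV[R]_n)); apply: filterS => v.
  by rewrite !fctE /dotvr /= subr0 addrK opprD addrA.
have dF := diff_unique (dotvr_continuous q) Fo.
split; last by move=> v; rewrite dF.
by apply/diff_locallyP; rewrite dF; split => //; exact: dotvr_continuous.
Qed.

Lemma diff_grad F x v : 'd F x v = dotv v (grad F x).
Proof.
rewrite [in LHS](row_sum_delta v) linear_sum; apply: eq_bigr => i _.
by rewrite linearZ mxE.
Qed.

End gradient.

(** * Legendre duality for a strictly convex potential *)

Lemma closed_ball_rV_compact {R : realType} {n : nat} (z0 : 'rV[R]_n) (r : R) :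
  compact [set z | `|z - z0| <= r].
Proof.
apply: bounded_closed_compact.
  exists (`|z0| + r); split; first exact: num_real.
  move=> M ltM z /= zr; apply: le_trans (ltW ltM).
  by rewrite -[z](subrK z0) addrC (le_trans (ler_normD _ _))// lerD2l.
have := @closed_closed_ball_ R 'rV[R]_n z0 r.
by congr (closed _); apply/seteqP; split => z /=; rewrite /closed_ball_/= distrC.
Qed.

Section legendre.
Context {R : realType} {n : nat}.
Variables (psi : 'rV[R]_n -> R) (D : 'rV[R]_n -> 'rV[R]_n).
Hypothesis subgradient :
  forall z z', z' != z -> psi z + dotv (z' - z) (D z) < psi z'.
Hypothesis D_continuous : continuous D.

Implicit Types (c w y z : 'rV[R]_n) (e r : R).

Lemma subgradient_le z z' : psi z + dotv (z' - z) (D z) <= psi z'.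
Proof.
have [->|/(subgradient z z')/ltW//] := eqVneq z' z.
by rewrite subrr -(scale0r 0) dotvZl mul0r addr0.
Qed.

(** Adding the strict inequalities for [(z, z')] and [(z', z)] gives strict monotonicity of [D]. *)
Lemma subgradient_inj : injective D.
Proof.
move=> z z' Dzz'; apply: contrapT => /eqP zz'.
have := subgradient _ _ zz'; rewrite eq_sym in zz'; have := subgradient _ _ zz'.
by rewrite Dzz' !dotvE {Dzz' zz'} => ? ?; lra.
Qed.

Lemma DinvK : cancel D (Dinv D).
Proof.
move=> z; apply: subgradient_inj.
by apply: (@xgetPex _ 0 [set z' | D z' = D z]); exists z.
Qed.

(** The subgradient inequality at [z] bounds [psi z'] below, the one at [z'] bounds it above; both
    bounds tend to [psi z]. *)
Lemma potential_continuous : continuous psi.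
Proof.
move=> z; apply: (@squeeze_cvgr _ (nbhs z) _ _ (fun z' => psi z + dotv (z' - z) (D z))
  (fun z' => psi z + dotv (z' - z) (D z'))).
- apply: nearW => z'; rewrite subgradient_le/=.
  by have := subgradient_le z' z; rewrite !dotvE; lra.
- rewrite -[X in _ --> X]addr0; apply: cvgD; first exact: cvg_cst.
  rewrite -(mul0r (dotv 0 (D z))) -dotvZl scale0r -[X in dotv X](subrr z).
  by apply: cvg_dotv; [apply: cvgB; [exact: cvg_id|exact: cvg_cst]|exact: cvg_cst].
- rewrite -[X in _ --> X]addr0; apply: cvgD; first exact: cvg_cst.
  rewrite -(mul0r (dotv 0 (D z))) -dotvZl scale0r -[X in dotv X](subrr z).
  by apply: cvg_dotv; [apply: cvgB; [exact: cvg_id|exact: cvg_cst]|exact: D_continuous].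
Qed.

(** Strict convexity makes the Bregman gap positive away from [z0]; compactness of the sphere makes
    the bound uniform. *)
Lemma sphere_gap z0 r : 0 < r -> exists2 delta, 0 < delta & forall z,
  `|z - z0| = r -> delta <= psi z - psi z0 - dotv (z - z0) (D z0).
Proof.
move=> r0; pose S := [set z : 'rV[R]_n | `|z - z0| = r].
(* The sphere is empty when [n = 0], and any positive [delta] then works. *)
have [S0|S0] := pselect (S !=set0); last first.
  by exists 1 => // z zr; exfalso; apply: S0; exists z.
have cnorm : continuous (fun z => `|z - z0|).
  move=> z; apply: (@cvg_norm _ _ _ (nbhs z)).
  by apply: cvgB; [exact: cvg_id|exact: cvg_cst].
have cS : compact S.
  apply: (subclosed_compact _ (closed_ball_rV_compact z0 r)) => [|z /= ->//].
  have -> : S = (fun z => `|z - z0|) @^-1` [set r] by [].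
  by apply: closed_comp; [move=> z _; exact: cnorm|exact: closed_eq].
have cphi : continuous (fun z => psi z - psi z0 - dotv (z - z0) (D z0)).
  move=> z; apply: (@cvgB _ _ _ (nbhs z)).
    by apply: cvgB; [exact: potential_continuous|exact: cvg_cst].
  by apply: cvg_dotv; [apply: cvgB; [exact: cvg_id|exact: cvg_cst]|exact: cvg_cst].
have [c cSc cmin] := compact_EVT_min S0 cS (continuous_subspaceT cphi).
exists (psi c - psi z0 - dotv (c - z0) (D z0)); last first.
  by move=> z zr; apply: cmin; rewrite inE.
have /(subgradient z0 c) : c != z0.
  by apply: contraTneq r0 => cz0; move: cSc; rewrite inE /S/= cz0 subrr normr0 => <-; rewrite ltxx.
by lra.
Qed.

(* First-order optimality of an interior minimiser, obtained from the
   subgradient inequality and the continuity of D alone. *)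
Lemma interior_min_grad z0 r y c : `|c - z0| < r ->
  (forall z, `|z - z0| <= r -> psi c - dotv c y <= psi z - dotv z y) -> D c = y.
Proof.
move=> cr cmin; apply/eqP; rewrite -subr_eq0 -dotvv_eq0; set w := D c - y.
rewrite eq_le dotvv_ge0 andbT leNgt; apply/negP => w0.
(* A short step along [- w] stays in the ball. Minimality of [c] and the subgradient inequality at
   the new point force [dotv w (D (c - e *: w) - y) <= 0], yet this quantity tends to
   [dotv w w > 0]. *)
have ccurve : (fun e : R => c - e *: w) @ 0^'+ --> c.
  rewrite -[X in _ --> X]subr0 -(scale0r w); apply: cvgB; first exact: cvg_cst.
  by apply: cvgZr_tmp; apply: cvg_at_right_filter; exact: cvg_id.
have cD : (fun e : R => dotv w (D (c - e *: w) - y)) @ 0^'+ --> dotv w w.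
  apply: cvg_dotv; first exact: cvg_cst.
  by apply: cvgB; [exact: (cvg_comp _ _ ccurve (D_continuous _))|exact: cvg_cst].
near (0 : R)^'+ => e.
have e0 : 0 < e by [].
have : 0 < dotv w (D (c - e *: w) - y).
  by near: e; apply: cvgr_gt w0; exact: cD.
have : `|c - e *: w - z0| <= r.
  apply: ltW; near: e; apply: cvgr_lt cr; rewrite -/(_ @ _).
  by apply: cvg_norm; apply: cvgB; [exact: ccurve|exact: cvg_cst].
move=> /cmin; have := subgradient_le (c - e *: w) c.
rewrite -(pmulr_rgt0 _ e0) opprB addrCA subrr addr0 !dotvE => h1 h2 h3.
by lra.
Unshelve. all: by end_near. Qed.

(** Minimise [psi z - dotv z y] over the closed ball. For [y] close to [D z0] the sphere gap keeps
    the minimiser [c] in the interior, where [D c = y]. *)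
Lemma subgradient_local_surj z0 r : 0 < r ->
  \forall y \near D z0, exists2 z, `|z - z0| < r & D z = y.
Proof.
move=> r0; have [delta d0 gap] := sphere_gap z0 r r0.
near=> y.
have cphi : continuous (fun z => psi z - dotv z y).
  move=> z; apply: (@cvgB _ _ _ (nbhs z)); first exact: potential_continuous.
  by apply: cvg_dotv; [exact: cvg_id|exact: cvg_cst].
have C0 : [set z | `|z - z0| <= r] !=set0 by exists z0; rewrite /= subrr normr0 ltW.
(* This radius makes the perturbation [dotv (c - z0) (y - D z0)] smaller than [delta]; the [+ 1]
   keeps the denominator positive when [n = 0]. *)
have y_near : `|y - D z0| < delta / (n%:R * r + 1).
  near: y; apply: (@cvgr_distC_lt _ _ _ (nbhs (D z0)) _ id); first exact: cvg_id.
  by rewrite divr_gt0// ltr_pwDr// mulr_ge0// ltW.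
have [c] := compact_EVT_min C0 (closed_ball_rV_compact z0 r) (continuous_subspaceT cphi).
rewrite inE/= => cr cmin'.
have cmin z : `|z - z0| <= r -> psi c - dotv c y <= psi z - dotv z y.
  by move=> zr; apply: cmin'; rewrite inE.
suff cltr : `|c - z0| < r by exists c => //; exact: interior_min_grad z0 r y c cltr cmin.
rewrite lt_neqAle cr andbT; apply/eqP => /[dup] cer /gap.
have := cmin z0; rewrite subrr normr0 => /(_ (ltW r0)) h1.
have : dotv (c - z0) (y - D z0) < delta.
  rewrite (le_lt_trans (ler_norm _))// (le_lt_trans (ler_norm_dotv _ _))// cer.
  move: y_near; rewrite ltr_pdivlMr ?ltr_pwDr ?mulr_ge0 ?(ltW r0)//.
  by have := normr_ge0 (y - D z0); lra.
by move: h1; rewrite !dotvE; lra.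
Unshelve. all: by end_near. Qed.

Lemma Dinv_continuous z0 : Dinv D @ D z0 --> z0.
Proof.
apply/(@cvgrPdist_lt _ _ _ (nbhs (D z0))) => r r0.
apply: (@filterS _ (nbhs (D z0))) (subgradient_local_surj z0 r r0) => y [z zr <-].
by rewrite DinvK distrC.
Qed.

(** Openness of the range: near [D z0], [Dinv] never takes its default value. *)
Lemma near_DinvK z0 : \forall y \near D z0, D (Dinv D y) = y.
Proof.
by apply: (@filterS _ (nbhs (D z0))) (subgradient_local_surj z0 1 ltr01) => y [z _ <-]; rewrite DinvK.
Qed.

(** On the range of [D] this is the Legendre conjugate of [psi], the supremum over [z] of
    [dotv z y - psi z], attained at [Dinv D y]. *)
Definition conjugate y := dotv y (Dinv D y) - psi (Dinv D y).

Lemma conjugate_young z y : D (Dinv D y) = y -> dotv z y - psi z <= conjugate y.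
Proof.
move=> yK; have := subgradient_le (Dinv D y) z.
by rewrite yK /conjugate dotvDl dotvNl (dotvC y); lra.
Qed.

(** The subgradient inequalities between [z0] and [Dinv D y] place the remainder between 0 and
    [dotv (y - D z0) (Dinv D y - z0)], which is small by continuity of [Dinv D]. So the conjugate
    has gradient [z0] at [D z0]. *)
Lemma conjugate_expansion z0 e : 0 < e -> \forall y \near D z0,
  `|conjugate y - conjugate (D z0) - dotv (y - D z0) z0| <= e * `|y - D z0|.
Proof.
move=> e0; near=> y.
have yK : D (Dinv D y) = y by near: y; exact: near_DinvK.
have zz0 : n%:R * `|Dinv D y - z0| <= e.
  have : `|Dinv D y - z0| < e / (n%:R + 1).
    near: y; apply: (@cvgr_distC_lt _ _ _ (nbhs (D z0)) _ (Dinv D)).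
      exact: Dinv_continuous.
    by rewrite divr_gt0// ltr_pwDr.
  rewrite ltr_pdivlMr ?ltr_pwDr//.
  by have := normr_ge0 (Dinv D y - z0); lra.
have := subgradient_le z0 (Dinv D y); have := subgradient_le (Dinv D y) z0.
rewrite yK /conjugate DinvK => h1 h2.
have := ler_norm_dotv (y - D z0) (Dinv D y - z0).
rewrite ler_norml => /andP[_ h3].
have h4 := ler_wpM2l (normr_ge0 (y - D z0)) zz0.
rewrite ger0_norm; move: h1 h2 h3 h4; rewrite !dotvE ?(dotvC z0) ?(dotvC (Dinv D y)); lra.
Unshelve. all: by end_near. Qed.

End legendre.

(** * The descent lemma and the quadratic majorizer *)

Lemma taylor_bound {R : realType} (phi dphi : R -> R) (K : R) :
  (forall b : R, is_derive b 1 phi (dphi b)) ->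
  (forall b, 0 < b -> `|dphi b - dphi 0| <= K * b) ->
  `|phi 1 - phi 0 - dphi 0| <= K / 2.
Proof.
move=> phiE dphiK.
suff bound (c : R) : `|c| = 1 -> c * (phi 1 - phi 0 - dphi 0) <= K / 2.
  have := bound 1 (normr1 _); have := bound (-1) (normrN1 _).
  by rewrite ler_norml; lra.
(* The sign [c] covers both bounds. By the mean value theorem [chi 1 - chi 0] is a value of [dchi]
   inside the interval, and it is nonpositive by the bound on [dphi]. *)
move=> c1; pose chi (b : R) := c * (phi b - b * dphi 0) - b ^+ 2 * (K / 2).
pose dchi (b : R) := c * (dphi b - dphi 0) - b * K.
have chiE (b : R) : is_derive b 1 chi (dchi b).
  rewrite /chi /dchi; apply: is_derive_eq; move: (dphi b) (dphi 0) => p q.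
  by rewrite !scaler0 !add0r /GRing.scale/=; field.
have cchi : continuous chi.
  by move=> b; apply/differentiable_continuous/derivable1_diffP; apply: ex_derive.
have [b] := @MVT R chi dchi 0 1 ltr01 (fun b _ => chiE b) (continuous_subspaceT cchi).
rewrite in_itv/= => /andP[b0 b1].
rewrite /chi subr0 mulr1 expr1n expr0n/= !mul0r !mul1r !subr0 => chi01.
suff : dchi b <= 0 by rewrite -chi01; lra.
rewrite /dchi subr_le0 (le_trans (ler_norm _))// normrM c1 mul1r mulrC.
exact: dphiK.
Qed.

Section descent.
Context {R : realType} {n : nat}.
(* G stands for grad g; keeping it abstract stops unification from unfolding
   the differential. *)
Variables (g : 'rV[R]_n -> R) (G : 'rV[R]_n -> 'rV[R]_n) (L : R).
Hypothesis g_diff : forall y, differentiable g y.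
Hypothesis dG : forall x v, 'd g x v = dotv v (G x).
Hypothesis G_lip :
  forall y1 y2, enorm (G y1 - G y2) <= L * enorm (y1 - y2).
Implicit Types (x y s v : 'rV[R]_n).

Lemma is_derive_line x v (a : R) :
  is_derive a 1 (fun b : R => g (x + b *: v)) (dotv v (G (x + a *: v))).
Proof.
have quotE : (fun h : R => h^-1 *: (((fun b : R => g (x + b *: v)) \o shift a) (h *: 1) -
    g (x + a *: v))) =
  (fun h : R => h^-1 *: ((g \o shift (x + a *: v)) (h *: v) - g (x + a *: v))).
  apply/funext => h; rewrite /= scalerDl addrCA.
  by have -> : h *: (1 : R) = h by rewrite /GRing.scale/= mulr1.
split; first by rewrite /derivable quotE; exact: diff_derivable.
by rewrite /derive quotE -dG -deriveE.
Qed.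

(** Along the segment, Cauchy-Schwarz and the Lipschitz bound control the slope of [g]. The upper
    half serves nonnegativity of the majorizer gap, the lower half the estimate of its gradient. *)
Lemma descent_lemma x v :
  `|g (x + v) - g x - dotv v (G x)| <= L / 2 * dotv v v.
Proof.
have := taylor_bound (fun b : R => g (x + b *: v)) (fun b : R => dotv v (G (x + b *: v)))
  (L * dotv v v) (is_derive_line x v).
rewrite scale1r scale0r addr0 mulrAC; apply => b b0.
rewrite -dotvNr -dotvDr.
set w := G _ - G x.
have wv : enorm v * enorm w <= L * dotv v v * b.
  have wL : enorm w <= L * (b * enorm v).
    rewrite -(gtr0_norm b0) -enormZ (_ : b *: v = x + b *: v - x); last first.
      by rewrite addrAC subrr add0r.
    exact: G_lip.
  have := ler_wpM2l (enorm_ge0 v) wL; rewrite -sqr_enorm expr2 => /le_trans; apply.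
  by rewrite le_eqVlt; apply/orP; left; apply/eqP; ring.
rewrite ler_norml (le_trans (dotv_le_enorm _ _) wv) andbT lerNl.
by rewrite -dotvNl (le_trans (dotv_le_enorm _ _))// enormN.
Qed.

Variable gamma : R.
Hypotheses (gamma0 : 0 < gamma) (L0 : 0 < L) (gammaL : gamma <= L^-1).

(** This is mu - f: the regularizer cancels, leaving an expression in [g] alone. *)
Definition majorizer_gap s y :=
  g s + dotv (y - s) (G s) + dotv (y - s) (y - s) / (2 * gamma) - g y.

Lemma majorizer_gap_ge0 s y : 0 <= majorizer_gap s y.
Proof.
have := descent_lemma s (y - s); rewrite subrKC ler_norml => /andP[_ h].
have Lg : L <= gamma^-1 by rewrite -(invrK L) lef_pV2 ?posrE ?invr_gt0.
have := ler_wpM2r (dotvv_ge0 (y - s)) Lg.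
by rewrite /majorizer_gap invfM; lra.
Qed.

(* A nonnegative function with M-Lipschitz gradient q satisfies
   |q|^2 <= 2 M lambda: evaluate it at y - q / M. *)
Lemma majorizer_gap_grad s y q :
  q = G s - G y + gamma^-1 *: (y - s) ->
  dotv q q <= 2 * (L + gamma^-1) * majorizer_gap s y.
Proof.
move=> qE; set M := L + gamma^-1.
have M0 : 0 < M by rewrite addr_gt0 ?invr_gt0.
have h1 := majorizer_gap_ge0 s (y - M^-1 *: q).
have := descent_lemma y (- (M^-1 *: q)); rewrite ler_norml => /andP[h2 _].
have h3 : dotv q q / M = dotv q (G s) / M - dotv q (G y) / M +
  gamma^-1 * (dotv q (y - s)) / M.
  by rewrite {2}qE !dotvE; field; rewrite !gt_eqF.
suff : dotv q q / M / 2 <= majorizer_gap s y.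
  by rewrite !ler_pdivrMr//; lra.
move: h1 h2 h3; rewrite /majorizer_gap.
have -> : y - M^-1 *: q - s = (y - s) - M^-1 *: q by rewrite addrAC.
rewrite !(dotvDl (y - s)) !(dotvDr (y - s)) !dotvNl !dotvNr !dotvZl !dotvZr invfM.
rewrite (dotvC (y - s) q).
(* The quadratic terms, [L / 2] from the descent lemma and [gamma^-1 / 2] from the gap, add up to
   [M / 2], so the step costs half of its linear gain [dotv q q / M]. *)
have h4 : M^-1 * (M^-1 * dotv q q) * (L + gamma^-1) = dotv q q / M.
  by rewrite -/M; field; rewrite gt_eqF.
clear qE; clearbody M => h1 h2 h3; lra.
Qed.

End descent.

(** * The iteration for an abstract potential and its gradient map *)

Section pnp.
Context {R : realType} {n : nat}.
Variables (psi : 'rV[R]_n -> R) (D : 'rV[R]_n -> 'rV[R]_n).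
Hypothesis subgradient :
  forall z z', z' != z -> psi z + dotv (z' - z) (D z) < psi z'.
Hypothesis D_continuous : continuous D.
Variables (g : 'rV[R]_n -> R) (G : 'rV[R]_n -> 'rV[R]_n) (L gamma : R).
Hypothesis g_diff : forall y, differentiable g y.
Hypothesis dG : forall x v, 'd g x v = dotv v (G x).
Hypothesis G_lip :
  forall y1 y2, enorm (G y1 - G y2) <= L * enorm (y1 - y2).
Hypotheses (gamma0 : 0 < gamma) (L0 : 0 < L) (gammaL : gamma <= L^-1).
Implicit Types (x y z s v : 'rV[R]_n).

Definition penalty y := gamma^-1 * (conjugate psi D y - dotv y y / 2).

Lemma grad_penalty z0 :
  grad (fun y => g y + penalty y) (D z0) = G (D z0) + gamma^-1 *: (z0 - D z0).
Proof.
set x := D z0.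
have [dh hE] : differentiable penalty x /\
    forall v, 'd penalty x v = dotv v (gamma^-1 *: (z0 - x)).
  apply: diff_dotv => e e0; near=> y.
  (* The tolerance, multiplied by [gamma], is split in two: one half for the remainder of the
     conjugate, one for the second-order term [dotv (y - x) (y - x) / 2]. *)
  have h1 : `|conjugate psi D y - conjugate psi D x - dotv (y - x) z0| <=
      (gamma * e / 2) * `|y - x|.
    by near: y; apply: conjugate_expansion => //; rewrite divr_gt0// mulr_gt0.
  have h2 : `|y - x| < (gamma * e / 2) / (n%:R + 1).
    near: y; apply: (@cvgr_distC_lt _ _ _ (nbhs x) _ id); first exact: cvg_id.
    by rewrite !divr_gt0// ?ltr_pwDr// mulr_gt0.
  have -> : penalty y - penalty x - dotv (y - x) (gamma^-1 *: (z0 - x)) =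
      gamma^-1 * ((conjugate psi D y - conjugate psi D x - dotv (y - x) z0) -
                  dotv (y - x) (y - x) / 2).
    by rewrite /penalty !dotvE (dotvC x y); field; rewrite gt_eqF.
  rewrite normrM gtr0_norm ?invr_gt0// ler_pdivrMl// (le_trans (ler_normB _ _))//.
  have h3 := ler_norm_dotv (y - x) (y - x).
  move: h2; rewrite ltr_pdivlMr ?ltr_pwDr// => h2.
  have h4 := ler_wpM2r (normr_ge0 (y - x)) (ltW h2).
  have h5 : 0 <= `|y - x| * `|y - x| by rewrite mulr_ge0.
  have h6 := mulr_ge0 (ler0n R n) h5.
  rewrite normrM (ger0_norm (x := 2^-1))//.
  by move: h1; lra.
have dE v : 'd (fun y => g y + penalty y) x v = dotv v (G x + gamma^-1 *: (z0 - x)).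
  by rewrite (diffD (f := g) (g := penalty) (g_diff _) dh)/= hE dG -dotvDr.
apply/rowP => i; rewrite -[RHS]dotv_delta -dE.
by rewrite /grad mxE.
Unshelve. all: by end_near. Qed.

(** Since [G s = gamma^-1 *: (s - z)], completing the square gives [gamma] mu(y) =
    [conjugate psi D y - dotv z y] plus a constant. Fenchel-Young bounds this below at [s], with
    equality at [D z]; finally mu(s) = f(s). *)
Lemma penalty_step z s : D (Dinv D s) = s -> z = s - gamma *: G s ->
  (g (D z) + penalty (D z)) + majorizer_gap g G gamma s (D z) <= g s + penalty s.
Proof.
move=> sK zE; have GE : G s = gamma^-1 *: (s - z).
  by rewrite zE opprB addrC subrK scalerA mulVf ?scale1r// gt_eqF.
have := conjugate_young psi D subgradient z s sK.
rewrite -(ler_pM2l (x := gamma^-1)) ?invr_gt0// => h.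
have cz : conjugate psi D (D z) = dotv (D z) z - psi z.
  by rewrite /conjugate (DinvK psi).
rewrite /majorizer_gap GE /penalty cz invfM.
by move: h {sK zE GE cz}; rewrite !dotvE (dotvC s z) (dotvC s (D z)); lra.
Qed.

Variable x : nat -> 'rV[R]_n.
Hypothesis xE : forall t, x t.+1 = D (x t - gamma *: G (x t)).

Let f y := g y + penalty y.

Lemma cost_noninc t : D (Dinv D (x t)) = x t -> f (x t.+1) <= f (x t).
Proof.
move=> xtK; rewrite xE; apply: le_trans (penalty_step _ _ xtK erefl).
by rewrite lerDl; apply: (majorizer_gap_ge0 g G L).
Qed.

Lemma sqr_grad_cost_le t : D (Dinv D (x t)) = x t ->
  enorm (grad f (x t.+1)) ^+ 2 <= 2 * (L + gamma^-1) * (f (x t) - f (x t.+1)).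
Proof.
move=> xtK; rewrite sqr_enorm.
have M0 : 0 < 2 * (L + gamma^-1) by rewrite mulr_gt0// addr_gt0// invr_gt0.
apply: (@le_trans _ _ (2 * (L + gamma^-1) * majorizer_gap g G gamma (x t) (x t.+1))).
  (* The majorizer is stationary at [x t.+1], so there the gradient of the gap is minus that of
     [f]. *)
  have gE : - grad f (x t.+1) = G (x t) - G (x t.+1) + gamma^-1 *: (x t.+1 - x t).
    rewrite {1}xE grad_penalty -xE; apply/rowP => i; rewrite !mxE.
    by field; rewrite gt_eqF.
  have := majorizer_gap_grad g G L g_diff dG G_lip gamma gamma0 L0 gammaL _ _ _ gE.
  by rewrite !dotvE opprK.
rewrite (ler_pM2l M0) lerBrDl xE.
exact: penalty_step.
Qed.

Lemma grad_cost_cvg0 m : (forall z, m <= f (D z)) ->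
  (fun t => enorm (grad f (x t))) @ \oo --> 0.
Proof.
(* The index starts at 1 because [x 0] may lie outside the range of [D]. *)
move=> mf; pose u t := f (x t.+1).
have xK t : D (Dinv D (x t.+1)) = x t.+1 by rewrite xE (DinvK psi).
have u_noninc : {homo u : i j / (i <= j)%N >-> j <= i}.
  by apply/nonincreasing_seqP => t; apply: cost_noninc.
have u_cvg : cvgn u.
  apply: nonincreasing_is_cvgn => //.
  by exists m => _ [t _ <-]; rewrite /u xE.
have du0 : (fun t => u t - u t.+1) @ \oo --> 0.
  rewrite -(subrr (limn u)); apply: cvgB => //.
  by rewrite (cvg_shiftS u).
(* Two shifts: [u t - u t.+1] controls the gradient at [x t.+2]. *)
rewrite -(cvg_shiftS (fun t => enorm (grad f (x t)))).
rewrite -(cvg_shiftS (fun t => enorm (grad f (x t.+1)))).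
apply: (@squeeze_cvgr _ _ _ _ (cst 0)
  (fun t => Num.sqrt (2 * (L + gamma^-1) * (u t - u t.+1)))).
- apply: nearW => t; rewrite enorm_ge0/= -[leLHS]ger0_norm ?enorm_ge0// -sqrtr_sqr.
  by rewrite ler_wsqrtr// sqr_grad_cost_le.
- exact: cvg_cst.
- rewrite -[X in _ --> X]sqrtr0 -[X in Num.sqrt X](mulr0 (2 * (L + gamma^-1))).
  apply: continuous_cvg; first exact: sqrt_continuous.
  by apply: cvgM; [exact: cvg_cst|exact: du0].
Qed.

End pnp.

(** * Strict comparison of integrals and continuity under the integral *)

Lemma lt_Rintegral {d : measure_display} {T : measurableType d} {R : realType}
    (P : probability T R) (f1 f2 : T -> R) :
  P.-integrable setT (EFin \o f1) -> P.-integrable setT (EFin \o f2) ->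
  (forall t, f1 t <= f2 t) -> (P [set t | f1 t = f2 t] < 1)%E ->
  Rintegral P setT f1 < Rintegral P setT f2.
Proof.
(* Otherwise the integrals agree, so the nonnegative difference [f2 - f1] has integral 0 and
   vanishes almost everywhere. *)
move=> if1 if2 f12; apply: contraPlt => f21.
have if21 : P.-integrable setT (EFin \o (fun t => f2 t - f1 t)) := integrableB measurableT if2 if1.
have int0 : (\int[P]_x `|(f2 x - f1 x)%:E| = 0)%E.
  under eq_integral do rewrite abse_EFin ger0_norm ?subr_ge0//.
  rewrite -[LHS]fineK ?integrable_fin_num//.
  have -> : fine (\int[P]_x (f2 x - f1 x)%:E) = Rintegral P setT (fun t => f2 t - f1 t) by [].
  rewrite RintegralB//; congr EFin; apply/eqP.
  by rewrite subr_eq0 eq_le f21 le_Rintegral.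
have mf21 := measurable_int _ if21.
move/(ae_eq_integral_abs _ measurableT mf21) : int0 => [N [mN N0 subN]].
apply/negP; rewrite -leNgt.
have mE : measurable [set t | f1 t = f2 t].
  rewrite (_ : [set t | _] = (EFin \o (fun t => f2 t - f1 t)) @^-1` [set 0%E]).
    by rewrite -[X in measurable X]setTI; apply: mf21.
  apply/seteqP; split => t /=; first by move=> ->; rewrite subrr.
  by move=> [] /eqP; rewrite subr_eq0 => /eqP.
have : (P (~` [set t | f1 t = f2 t]) <= 0)%E.
  rewrite -N0; apply: le_measure; rewrite ?inE//; first exact: measurableC.
  move=> t /= nt; apply: subN => /= /(_ I) [] /eqP; rewrite subr_eq0 => /eqP.
  by move/esym.
by rewrite probability_setC// sube_le0.
Qed.

(** Reduces continuity to sequences, the setting of dominated convergence: a failure yields points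
    within [harmonic k] of [z] whose values stay [e] away from [F z]. *)
Lemma cvg_rV_seq {R : realType} {n : nat} (F : 'rV[R]_n -> R) (z : 'rV[R]_n) :
  (forall u : nat -> 'rV[R]_n, u @ \oo --> z -> (fun k => F (u k)) @ \oo --> F z) ->
  F @ z --> F z.
Proof.
move=> seqF; apply/(@cvgrPdist_lt _ _ _ (nbhs z)) => e e0.
apply: contrapT => notnear.
have /choice [u uP] : forall k : nat, exists y : 'rV[R]_n,
    `|z - y| < harmonic k /\ e <= `|F z - F y|.
  move=> k; apply: contrapT => noy; apply: notnear.
  have k0 : 0 < (harmonic k : R) by exact: harmonic_gt0.
  apply: (@filterS _ (nbhs z)) (cvgr_dist_lt (F := nbhs z) id z cvg_id _ k0) => y zy.
  by rewrite ltNge; apply/negP => ey; apply: noy; exists y.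
have uz : u @ \oo --> z.
  apply/cvgrPdist_lt => e' e'0.
  have := cvgr_lt _ (@cvg_harmonic R) e' e'0.
  move=> near_harm; near=> k; apply: (@lt_trans _ _ (harmonic k)).
    by case: (uP k).
  by near: k; exact: near_harm.
have [N _ /(_ N (leqnn _))] := cvgr_dist_lt _ _ (seqF _ uz) e e0.
by rewrite /= ltNge; case: (uP N) => _ ->.
Unshelve. all: by end_near. Qed.

Lemma bounded_Rintegral_continuous {d : measure_display} {T : measurableType d}
    {R : realType} {n : nat} (P : probability T R) (f : 'rV[R]_n -> T -> R) (B : R) :
  (forall z, measurable_fun setT (f z)) -> (forall t, continuous (f ^~ t)) ->
  (forall z t, `|f z t| <= B) -> continuous (fun z => Rintegral P setT (f z)).
Proof.
move=> mf cf fB z; apply: cvg_rV_seq => u uz.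
have iB : P.-integrable setT (EFin \o cst B) by exact: finite_measure_integrable_cst.
have [|||||ifz _ fcvg] := @dominated_convergence _ _ _ P setT measurableT
  (fun k => EFin \o f (u k)) (EFin \o f z) (EFin \o cst B).
- by move=> k; apply/measurable_EFinP.
- exact/measurable_EFinP.
- apply: aeW => t _; apply: cvg_EFin; first exact: nearW.
  exact: (cvg_comp _ _ uz (cf t z)).
- exact: iB.
- by apply: aeW => t k _; rewrite lee_fin.
apply: (fine_cvg (a := Rintegral P setT (f z))).
by rewrite /Rintegral fineK// integrable_fin_num.
Qed.

(** * The Gaussian MMSE denoiser and its potential *)

Section denoiser.
Context {d : measure_display} {T : measurableType d} {R : realType} {n : nat}.
Variables (P : probability T R) (X : T -> 'rV[R]_n) (sigma : R).
Hypothesis mX : forall i : 'I_n, measurable_fun setT (fun t => X t ord0 i).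
Hypothesis sigma0 : 0 < sigma.
Implicit Types (v z : 'rV[R]_n).

Let k0 : R := (Num.sqrt (2 * pi * sigma ^+ 2)) ^- n.

Lemma gauss_cst_gt0 : 0 < k0.
Proof.
by rewrite invr_gt0 exprn_gt0// sqrtr_gt0 !mulr_gt0// ?pi_gt0// exprn_gt0.
Qed.

Lemma gaussE v : gauss sigma v = k0 * expR (- (dotv v v / (2 * sigma ^+ 2))).
Proof. by rewrite /gauss sqr_enorm mulNr. Qed.

Lemma gauss_gt0 v : 0 < gauss sigma v.
Proof. by rewrite gaussE mulr_gt0 ?gauss_cst_gt0 ?expR_gt0. Qed.

Lemma gauss_le v : gauss sigma v <= k0.
Proof.
rewrite gaussE ger_pMr ?gauss_cst_gt0// -expR0 ler_expR oppr_le0.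
by rewrite divr_ge0 ?dotvv_ge0// mulr_ge0// sqr_ge0.
Qed.

(** The Gaussian weight bounds the coordinates of [z - X t], which makes the weighted coordinates
    integrable whatever the tails of the prior. *)
Lemma coord_gauss_le v i : `|v ord0 i * gauss sigma v| <= k0 * sigma.
Proof.
rewrite normrM (gtr0_norm (gauss_gt0 _)) gaussE mulrCA ler_pM2l ?gauss_cst_gt0//.
rewrite expRN ler_pdivrMr ?expR_gt0//.
have vi : v ord0 i ^+ 2 <= dotv v v.
  rewrite /dotv (bigD1 i)//= -expr2 lerDl.
  by apply: sumr_ge0 => j _; rewrite -expr2 sqr_ge0.
(* By [1 + u <= expR u], it remains to complete a square in [|v ord0 i| - sigma]. *)
apply: (@le_trans _ _ (sigma * (1 + v ord0 i ^+ 2 / (2 * sigma ^+ 2)))).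
  rewrite -subr_ge0 -real_normK ?num_real//.
  have -> : sigma * (1 + `|v ord0 i| ^+ 2 / (2 * sigma ^+ 2)) - `|v ord0 i| =
      (sigma ^+ 2 + (`|v ord0 i| - sigma) ^+ 2) / (2 * sigma).
    by field; rewrite gt_eqF.
  by rewrite divr_ge0 ?addr_ge0 ?sqr_ge0// mulr_ge0// ltW.
rewrite ler_pM2l// (le_trans _ (expR_ge1Dx _))// lerD2l.
by rewrite ler_wpM2r// invr_ge0 mulr_ge0// sqr_ge0.
Qed.

Lemma gauss_continuous : continuous (gauss sigma : 'rV[R]_n -> R).
Proof.
rewrite (_ : gauss sigma = fun v => k0 * expR (- (dotv v v / (2 * sigma ^+ 2)))).
  move=> v; apply: (@cvgM _ _ (nbhs v)); first exact: cvg_cst.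
  apply: continuous_cvg; first exact: continuous_expR.
  apply: cvgN; apply: cvgM; last exact: cvg_cst.
  by apply: cvg_dotv; exact: cvg_id.
by apply/funext => v; rewrite gaussE.
Qed.

Lemma measurable_dotv (f g : T -> 'rV[R]_n) :
  (forall i, measurable_fun setT (fun t => f t ord0 i)) ->
  (forall i, measurable_fun setT (fun t => g t ord0 i)) ->
  measurable_fun setT (fun t => dotv (f t) (g t)).
Proof. by move=> mf mg; apply: measurable_sum => i; exact: measurable_funM. Qed.

Lemma measurable_shift z i : measurable_fun setT (fun t => (z - X t) ord0 i).
Proof.
under eq_fun do rewrite !mxE.
by apply: measurable_funB => //; exact: measurable_cst.
Qed.

Lemma measurable_gauss z : measurable_fun setT (fun t => gauss sigma (z - X t)).
Proof.
under eq_fun do rewrite gaussE.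
apply: measurable_funM => //; apply: measurableT_comp => //.
apply: measurableT_comp => //; apply: measurable_funM => //.
by apply: measurable_dotv; exact: measurable_shift.
Qed.

Lemma measurable_coord_gauss z i :
  measurable_fun setT (fun t => (z - X t) ord0 i * gauss sigma (z - X t)).
Proof. by apply: measurable_funM; [exact: measurable_shift|exact: measurable_gauss]. Qed.

Lemma integrable_bounded (f : T -> R) (B : R) : measurable_fun setT f ->
  (forall t, `|f t| <= B) -> P.-integrable setT (EFin \o f).
Proof.
move=> mf fB; apply: measurable_bounded_integrable => //.
  by rewrite (le_lt_trans (probability_le1 P measurableT))// ltry.
exists B; split; first exact: num_real.
by move=> M BM t _ /=; rewrite (le_trans (fB t))// ltW.
Qed.

Lemma integrable_gauss z : P.-integrable setT (EFin \o (fun t => gauss sigma (z - X t))).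
Proof.
apply: (integrable_bounded _ k0) (measurable_gauss z) _ => t.
by rewrite gtr0_norm ?gauss_gt0 ?gauss_le.
Qed.

Lemma integrable_coord_gauss z i :
  P.-integrable setT (EFin \o (fun t => (z - X t) ord0 i * gauss sigma (z - X t))).
Proof.
exact: (integrable_bounded _ (k0 * sigma)) (measurable_coord_gauss z i) (fun t => coord_gauss_le _ _).
Qed.

Lemma pz_gt0 z : 0 < pz P X sigma z.
Proof.
have i0 : P.-integrable setT (EFin \o cst (0 : R)) by exact: finite_measure_integrable_cst.
have := lt_Rintegral P _ _ i0 (integrable_gauss z) (fun t => ltW (gauss_gt0 _)).
rewrite Rintegral_cst// mul0r; apply.
rewrite (_ : [set t | _] = set0) ?measure0 ?lte01//.
apply/seteqP; split => t //= /eqP; apply/negP.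
by rewrite eq_sym gt_eqF ?gauss_gt0.
Qed.

Lemma Rintegral_coord_gauss z i :
  Rintegral P setT (fun t => (z - X t) ord0 i * gauss sigma (z - X t)) =
  (z - mmse P X sigma z) ord0 i * pz P X sigma z.
Proof.
have iX : Rintegral P setT (fun t => X t ord0 i * gauss sigma (z - X t)) =
    z ord0 i * pz P X sigma z -
    Rintegral P setT (fun t => (z - X t) ord0 i * gauss sigma (z - X t)).
  rewrite -RintegralZl ?integrable_gauss// -RintegralB//; last 2 first.
  - exact: (integrableZl measurableT (z ord0 i) (integrable_gauss z)).
  - exact: integrable_coord_gauss.
  by apply: eq_Rintegral => t _; rewrite !mxE; ring.
by rewrite !mxE iX; field; rewrite gt_eqF ?pz_gt0.
Qed.

Lemma integrable_dotv_gauss v z :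
  P.-integrable setT (EFin \o (fun t => dotv v (z - X t) * gauss sigma (z - X t))).
Proof.
rewrite (_ : EFin \o _ = fun t => (\sum_(i < n)
    (v ord0 i * ((z - X t) ord0 i * gauss sigma (z - X t)))%:E)%E).
  apply: integrable_sum => // i _.
  exact: (integrableZl measurableT (v ord0 i) (integrable_coord_gauss z i)).
apply/funext => t; rewrite sumEFin/=; congr EFin.
by rewrite mulr_suml; apply: eq_bigr => i _; rewrite mulrA.
Qed.

Lemma Rintegral_dotv_gauss v z :
  Rintegral P setT (fun t => dotv v (z - X t) * gauss sigma (z - X t)) =
  dotv v (z - mmse P X sigma z) * pz P X sigma z.
Proof.
rewrite /Rintegral.
under eq_integral do rewrite mulr_suml -sumEFin.
rewrite integral_sum//; last first.
  move=> i; under eq_fun do rewrite -mulrA.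
  exact: (integrableZl measurableT (v ord0 i) (integrable_coord_gauss z i)).
rewrite -sum_fine; last first.
  move=> i _; apply: integrable_fin_num => //; under eq_fun do rewrite -mulrA.
  exact: (integrableZl measurableT (v ord0 i) (integrable_coord_gauss z i)).
rewrite mulr_suml; apply: eq_bigr => i _; rewrite -mulrA -Rintegral_coord_gauss.
rewrite -RintegralZl ?integrable_coord_gauss//.
by apply: eq_Rintegral => t _; rewrite mulrA.
Qed.

(** Written through the residual [z - mmse P X sigma z], the denoiser involves a quotient of two
    integrals with bounded continuous integrands and positive denominator. *)
Lemma mmse_continuous : continuous (mmse P X sigma).
Proof.
have gauss_cvg t z : (fun y => gauss sigma (y - X t)) @ z --> gauss sigma (z - X t).
  apply: (@cvg_comp _ _ _ (fun y => y - X t) (gauss sigma) _ (nbhs (z - X t))).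
    by apply: (@cvgB _ _ _ (nbhs z)); [exact: cvg_id|exact: cvg_cst].
  exact: gauss_continuous.
have coord_cvg t z i : (fun y => (y - X t) ord0 i) @ z --> (z - X t) ord0 i.
  apply: (@cvg_comp _ _ _ (fun y => y - X t) (fun w : 'rV[R]_n => w ord0 i) _ (nbhs (z - X t))).
    by apply: (@cvgB _ _ _ (nbhs z)); [exact: cvg_id|exact: cvg_cst].
  exact: coord_continuous.
have pz_cont : continuous (pz P X sigma).
  apply: (bounded_Rintegral_continuous P _ k0).
  - exact: measurable_gauss.
  - by move=> t z; exact: gauss_cvg.
  by move=> z t; rewrite gtr0_norm ?gauss_gt0 ?gauss_le.
move=> z; apply: (@cvg_rV _ _ _ (nbhs z)) => i.
have mmseE y : mmse P X sigma y ord0 i = y ord0 i -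
    Rintegral P setT (fun t => (y - X t) ord0 i * gauss sigma (y - X t)) / pz P X sigma y.
  by rewrite Rintegral_coord_gauss mulfK ?gt_eqF ?pz_gt0// !mxE opprB addrC subrK.
under eq_fun do rewrite mmseE.
rewrite mmseE; apply: (@cvgB _ _ _ (nbhs z)); first exact: coord_continuous.
apply: cvgM; last by apply: cvgV; [rewrite gt_eqF ?pz_gt0|exact: pz_cont].
have cont t : continuous (fun y : 'rV[R]_n => (y - X t) ord0 i * gauss sigma (y - X t)).
  by move=> y; apply: (@cvgM _ _ (nbhs y)); [exact: coord_cvg|exact: gauss_cvg].
exact: (bounded_Rintegral_continuous P _ (k0 * sigma) (fun y => measurable_coord_gauss y i)
  cont (fun y t => coord_gauss_le _ _)).
Qed.

(** By Tweedie's formula, D(z) = z + sigma^2 grad ln p_z(z) is the gradient of this function. *)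
Definition potential z := dotv z z / 2 + sigma ^+ 2 * ln (pz P X sigma z).

Hypothesis nondeg : nondeg_law P X.

(* Jensen's inequality for exp under the posterior of X given z, through the
   tangent line of exp at the mean m. *)
Lemma potential_shift v z w : w = v + z -> v != 0 ->
  potential z + dotv v (mmse P X sigma z) < potential w.
Proof.
move=> wE v0; move: (mmse P X sigma z) (Rintegral_dotv_gauss v z) => Dz int_dotv.
have s2 : 0 < sigma ^+ 2 by rewrite exprn_gt0.
(* The log-ratio of the Gaussian weights at [w] and [z] is [m + dev t]: [m] is its posterior mean
   and [dev] the centred part. The tangent line of exp at [m] gives [f1]. *)
pose m := (dotv v (Dz - z) - dotv v v / 2) / sigma ^+ 2.
pose dev t := dotv v (X t - Dz) / sigma ^+ 2.
pose f1 t := expR m * (gauss sigma (z - X t) * (1 + dev t)).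
have gaussz' t : gauss sigma (w - X t) = expR m * (gauss sigma (z - X t) * expR (dev t)).
  rewrite wE -addrA !gaussE [RHS]mulrCA -[RHS]mulrA -!expRD.
  congr (_ * expR _); rewrite /m /dev !dotvE (dotvC z v) (dotvC (X t) v).
  by field; rewrite gt_eqF.
have f1E t : f1 t = expR m * (1 + dotv v (z - Dz) / sigma ^+ 2) * gauss sigma (z - X t) -
    expR m / sigma ^+ 2 * (dotv v (z - X t) * gauss sigma (z - X t)).
  by rewrite /f1 /dev !dotvE; field; rewrite gt_eqF.
have if1 : P.-integrable setT (EFin \o f1).
  rewrite (funext f1E).
  exact: (integrableB measurableT
    (integrableZl measurableT (expR m * (1 + dotv v (z - Dz) / sigma ^+ 2)) (integrable_gauss z))
    (integrableZl measurableT (expR m / sigma ^+ 2) (integrable_dotv_gauss v z))).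
have int_f1 : Rintegral P setT f1 = expR m * pz P X sigma z.
  rewrite (funext f1E).
  rewrite RintegralB//; last 2 first.
  - exact: (integrableZl measurableT (expR m * (1 + dotv v (z - Dz) / sigma ^+ 2))
      (integrable_gauss z)).
  - exact: (integrableZl measurableT (expR m / sigma ^+ 2) (integrable_dotv_gauss v z)).
  rewrite (RintegralZl _ measurableT (integrable_gauss z)).
  rewrite (RintegralZl _ measurableT (integrable_dotv_gauss v z)).
  rewrite int_dotv -[Rintegral _ _ _]/(pz P X sigma z).
  by field; rewrite gt_eqF.
have : Rintegral P setT f1 < pz P X sigma w.
  apply: lt_Rintegral => //; first exact: integrable_gauss.
    move=> t; rewrite gaussz' ler_pM2l ?expR_gt0// ler_pM2l ?gauss_gt0//.
    exact: expR_ge1Dx.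
  (* Equality in [1 + u <= expR u] holds only at [u = 0], that is when [X t] lies on a hyperplane
     with normal [v]; non-degeneracy applies. *)
  rewrite (_ : [set t | _] = [set t | dotv v (X t) = dotv v Dz]); first exact: nondeg.
  apply/seteqP; split => t /=.
    move=> fE; apply/eqP; rewrite -subr_eq0; apply: contra_eqT fE => vX.
    rewrite lt_eqF// gaussz' ltr_pM2l ?expR_gt0// ltr_pM2l ?gauss_gt0//.
    apply: expR_gt1Dx; rewrite /dev dotvDr dotvNr mulf_neq0// invr_eq0 gt_eqF//.
  move=> vX; rewrite gaussz' /f1 /dev dotvDr dotvNr vX subrr mul0r.
  by rewrite expR0 addr0.
rewrite int_f1 -ltr_ln ?posrE ?mulr_gt0 ?expR_gt0 ?pz_gt0//.
rewrite lnM ?posrE ?expR_gt0 ?pz_gt0// expRK -(ltr_pM2l s2) mulrDr.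
have -> : sigma ^+ 2 * m = dotv v Dz - dotv v z - dotv v v / 2.
  by rewrite /m mulrC divfK ?gt_eqF// dotvDr dotvNr.
have ww : dotv w w = dotv v v + 2 * dotv v z + dotv z z.
  by rewrite wE !dotvE (dotvC z v); ring.
have arith (a b vD vz vv zz : R) : vD - vz - vv / 2 + a < b ->
    zz / 2 + a + vD < (vv + 2 * vz + zz) / 2 + b by lra.
by rewrite /potential ww; exact: arith.
Qed.

Lemma potential_subgradient z z' : z' != z ->
  potential z + dotv (z' - z) (mmse P X sigma z) < potential z'.
Proof.
by rewrite -subr_eq0; apply: potential_shift; rewrite subrK.
Qed.

End denoiser.

(** * Identification of the regularizer and conclusion *)

Lemma hformulaE {d : measure_display} {T : measurableType d} {R : realType} {n : nat}
    (P : probability T R) (X : T -> 'rV[R]_n) (sigma gamma : R) : 0 < gamma ->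
  hformula P X sigma gamma = penalty (potential P X sigma) (mmse P X sigma) gamma.
Proof.
move=> gamma0; apply/funext => y; rewrite /hformula /penalty /conjugate /potential /hsigma.
move: (Dinv (mmse P X sigma) y) => z; move: (ln (pz P X sigma z)) => lz.
(* Expanding the square, the term [dotv z z / 2] and the logarithm recombine into [potential]. *)
by rewrite sqr_enorm !dotvE (dotvC z y); field; rewrite gt_eqF.
Qed.

Theorem theorem1 (d : measure_display) (T : measurableType d) (R : realType)
  (n : nat) (P : probability T R) (X : T -> 'rV[R]_n)
  (sigma L gamma : R) (g : 'rV[R]_n -> R) (x : nat -> 'rV[R]_n) :
  (forall i : 'I_n, measurable_fun setT (fun t => X t ord0 i)) ->
  nondeg_law P X ->
  0 < sigma ->
  0 < L ->
  (forall y, differentiable g y) ->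
  continuous (grad g) ->
  (forall y1 y2, enorm (grad g y1 - grad g y2) <= L * enorm (y1 - y2)) ->
  0 < gamma -> gamma <= L^-1 ->
  (exists m : R, forall y, (m%:E <= fcost P X sigma gamma g y)%E) ->
  (forall t, x t.+1 = mmse P X sigma (x t - gamma *: grad g (x t))) ->
  (forall t, (fcost P X sigma gamma g (x t.+1) <= fcost P X sigma gamma g (x t))%E)
  /\ (fun t => enorm (gradf P X sigma gamma g (x t))) @ \oo --> 0.
Proof.
move=> mX nondeg sigma0 L0 g_diff _ g_lip gamma0 gammaL [m mf] xE.
have subgrad := potential_subgradient P X sigma mX sigma0 nondeg.
have D_cont := mmse_continuous P X sigma mX sigma0.
have fcostE z : fcost P X sigma gamma g (mmse P X sigma z) =
    (g (mmse P X sigma z) +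
     penalty (potential P X sigma) (mmse P X sigma) gamma (mmse P X sigma z))%:E.
  rewrite /fcost /hreg asboolT; last by exists z.
  by rewrite hformulaE.
have dg : forall y v, 'd g y v = dotv v (grad g y) by exact: diff_grad.
split=> [t|].
  (* Only [x 0] can lie outside the range; its cost is then [+oo] and the inequality is trivial. *)
  have [[z _ zx]|xt] := pselect (range (mmse P X sigma) (x t)); last first.
    by rewrite {2}/fcost /hreg asboolF// leey.
  have xtK : mmse P X sigma (Dinv (mmse P X sigma) (x t)) = x t.
    by rewrite -zx (DinvK _ _ subgrad).
  rewrite xE fcostE -zx fcostE lee_fin zx -xE.
  exact: (cost_noninc _ _ subgrad g (grad g) L gamma g_diff dg g_lip gamma0 L0 gammaL x xE).
rewrite /gradf hformulaE//.
apply: (grad_cost_cvg0 _ _ subgrad D_cont g (grad g) L gamma g_diff dg g_lip gamma0 L0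
  gammaL x xE m) => z.
by rewrite -lee_fin -fcostE.
Qed.
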